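(* Let $K$ be a finitely generated torsion-free group for which there exists $u>1$ such that every finitely generated subgroup $H$ of $K$ either satisfies $\omega(H)\geq u$ or is cyclic. Let $G=K\rtimes\mathbb{Z}$ be any non-proper HNN extension of $K$. Then for every finitely generated subgroup $S$ of $G$, either $S$ has uniform exponential growth with $\omega(S)\geq\min(u^{1/6},2^{1/16})$, or $S$ is isomorphic to $\{e\}$, $\mathbb{Z}$, $\mathbb{Z}\times\mathbb{Z}$ or the Klein bottle group.
   Context: For a finitely generated group $G$ and a finite generating set $A$ of $G$, let $\gamma_A(n)$ be the number of elements of $G$ of word length at most $n$ with respect to $A\cup A^{-1}$, and let $\omega(G,A)=\lim_{n\to\infty}\gamma_A(n)^{1/n}$ (the limit exists since $\gamma_A$ is submultiplicative). The growth constant of $G$ is $\omega(G)=\inf_A \omega(G,A)$, the infimum being over all finite generating sets $A$ of $G$. $G$ has uniform exponential growth if $\omega(G)>1$. A non-proper HNN extension of $K$ is a semidirect product $K\rtimes_\alpha\mathbb{Z}=\langle K,t\mid tkt^{-1}=\alpha(k)\ (k\in K)\rangle$ for an automorphism $\alpha$ of $K$. Cyclic groups include the trivial group. The Klein bottle group is $\langle a,t\mid tat^{-1}=a^{-1}\rangle$. *)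

(* Defs.v *)
From HB Require Import structures.
From mathcomp Require Import all_boot all_order all_algebra finmap.
From mathcomp Require Import all_classical all_reals all_analysis.

Set Implicit Arguments.
Unset Strict Implicit.
Unset Printing Implicit Defensive.

Import Order.TTheory GRing.Theory Num.Theory.
Import numFieldNormedType.Exports.

Local Open Scope classical_set_scope.
Local Open Scope group_scope.

Section Subgroups.
Context {G : groupType}.
Implicit Types (A S : set G) (x : G).

Definition is_subgroup S :=
  [/\ S 1, (forall x y, S x -> S y -> S (x * y)) & (forall x, S x -> S x^-1)].

Definition generated A : set G := smallest is_subgroup A.

Definition finite_generating_set S A := finite_set A /\ generated A = S.

Definition finitely_generated S := exists A, finite_generating_set S A.

Definition is_cyclic S := exists x, S = generated [set x].

Definition isomorphic_to S (T : groupType) :=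
  exists f : {multiplicative T -> G}, injective f /\ range f = S.

End Subgroups.

Definition torsion_free (G : groupType) :=
  forall (x : G) (n : nat), (0 < n)%N -> x ^+ n = 1 -> x = 1.

Section Growth.
Context {G : groupType}.
Implicit Types (A S : set G) (n : nat).

Definition word_ball A n : set G :=
  [set x | exists w : seq G,
     [/\ (size w <= n)%N, (forall a, a \in w -> A a \/ A a^-1)
       & x = \prod_(a <- w) a]].

(* [fset_set] is the empty set on infinite sets; by [finite_word_ball] below
   this default value is not used when [A] is finite. *)
Definition growth_function A n : nat := #|` fset_set (word_ball A n)|%fset.

Lemma finite_word_ball A n : finite_set A -> finite_set (word_ball A n).
Proof.
move=> finA; pose B := A `|` [set a^-1 | a in A].
have finB : finite_set B by rewrite finite_setU; split=> //; exact: finite_image.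
elim: n => [|n IHn].
  apply: (@sub_finite_set _ _ [set 1]); last exact: finite_set1.
  by move=> x [[|a w] [sz_w _ ->]] /=; rewrite ?big_nil.
apply: (@sub_finite_set _ _ ([set 1] `|`
   [set p.1 * p.2 | p in B `*` word_ball A n])); last first.
  rewrite finite_setU; split; first exact: finite_set1.
  by apply: finite_image; apply: finite_setX.
move=> x [[|a w] [sz_w Aw ->]]; first by left; rewrite /= big_nil.
right; exists (a, \prod_(b <- w) b) => /=; last by rewrite big_cons.
split=> /=.
  have [Aa|Aa] := Aw a (mem_head _ _); first by left.
  by right; exists a^-1 => //; rewrite invgK.
by exists w; split=> // b bw; apply: Aw; rewrite inE bw orbT.
Qed.

Definition growth_rate (R : realType) A : R :=
  limn (fun n : nat => ((growth_function A n)%:R `^ (n%:R^-1))%R : R).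

Definition growth_constant (R : realType) S : R :=
  inf [set growth_rate R A | A in finite_generating_set S].

Definition uniform_exponential_growth (R : realType) S :=
  (1 < growth_constant R S)%R.

End Growth.

Section IntIter.
Context {T : Type}.
Implicit Types (f g : T -> T) (n : int).

(* The integer power of the permutation [f] with inverse [g]. *)
Definition iterz f g n : T -> T :=
  match n with Posz k => iter k f | Negz k => iter k.+1 g end.

Lemma iterzS f g n x : cancel g f -> iterz f g (1 + n)%R x = f (iterz f g n x).
Proof.
move=> gK; case: n => [n|n]; first by rewrite -intS.
rewrite [RHS]/= gK NegzE intS opprD addrA subrr add0r.
by case: n => //= n; rewrite -NegzE.
Qed.

Lemma iterzP f g n x : cancel f g ->
  iterz f g (-1 + n)%R x = g (iterz f g n x).
Proof.
move=> fK; case: n => [[|n]|n]; first by rewrite addr0.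
  by rewrite intS addKr /= fK.
by rewrite NegzE -opprD -intS -NegzE.
Qed.

Lemma iterzD f g m n x : cancel f g -> cancel g f ->
  iterz f g (m + n)%R x = iterz f g m (iterz f g n x).
Proof.
move=> fK gK; elim/int_rec: m => [|m IHm|m IHm]; first by rewrite add0r.
  by rewrite intS -addrA !iterzS // IHm.
by rewrite intS opprD -addrA !iterzP // IHm.
Qed.

End IntIter.

Definition zexpg (G : groupType) (x : G) (m : int) : G :=
  match m with Posz n => x ^+ n | Negz n => x ^- n.+1 end.

Section IntPower.
Variable G : groupType.
Implicit Types (x y : G) (m n : int).

Lemma zexpg_iterz x m y : zexpg x m * y = iterz ( *%g x) ( *%g x^-1) m y.
Proof. by case: m => n /=; rewrite -?iterS iter_mulg // expVgn. Qed.

Lemma zexpgD x m n : zexpg x (m + n)%R = zexpg x m * zexpg x n.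
Proof.
rewrite -[LHS]mulg1 -[zexpg x n]mulg1 !zexpg_iterz iterzD //.
- exact: mulKg.
- exact: mulVKg.
Qed.

Lemma zexpgN x m : zexpg x (- m)%R = (zexpg x m)^-1.
Proof. by apply: (@mulIg _ (zexpg x m)); rewrite -zexpgD addNr mulVg. Qed.

Lemma eq_zexpg (f : int -> G) x : (forall m n, f (m + n)%R = f m * f n) ->
  f 1%R = x -> forall m, f m = zexpg x m.
Proof.
move=> fD f1 m; have f0 : f 0%R = 1.
  by apply: (@mulgI _ (f 0%R)); rewrite -fD addr0 mulg1.
have fN n : f (- n)%R = (f n)^-1.
  by apply: (@mulIg _ (f n)); rewrite -fD addNr mulVg.
have fP (n : nat) : f n = x ^+ n.
  by elim: n => // n IHn; rewrite intS fD f1 IHn expgS.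
by case: m => n; rewrite ?NegzE ?fN fP.
Qed.

End IntPower.

Record automorphism (K : groupType) := Automorphism {
  aut_fun :> {multiplicative K -> K};
  aut_inv : K -> K;
  aut_funK : cancel aut_fun aut_inv;
  aut_invK : cancel aut_inv aut_fun
}.

Definition autz (K : groupType) (alpha : automorphism K) : int -> K -> K :=
  iterz alpha (aut_inv alpha).

(* The non-proper HNN extension of [K] by [alpha]; [(k, m)] stands for
   [k * t ^ m]. *)
Definition semidirectZ (K : groupType) (alpha : automorphism K) : Type :=
  (K * int)%type.

Section SemidirectZ.
Variables (K : groupType) (alpha : automorphism K).
Implicit Types p q : semidirectZ alpha.

HB.instance Definition _ := Choice.on (semidirectZ alpha).

Lemma autzD m n k : autz alpha (m + n)%R k = autz alpha m (autz alpha n k).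
Proof. exact: iterzD (aut_funK _) (aut_invK _). Qed.

Lemma aut_invM : {morph aut_inv alpha : x y / x * y}.
Proof. exact: can2_gmulfM (aut_funK _) (aut_invK _). Qed.

Lemma autzM m : {morph autz alpha m : x y / x * y}.
Proof.
rewrite /autz; case: m => n x y /=; first by elim: n => //= n ->; rewrite gmulfM.
by rewrite -!iterS; elim: n.+1 => //= k ->; rewrite aut_invM.
Qed.

Lemma autz1 m : autz alpha m 1 = 1.
Proof. by apply: (@mulgI _ (autz alpha m 1)); rewrite -autzM !mulg1. Qed.

Definition semidirectZ_one : semidirectZ alpha := (1, 0%R).
Definition semidirectZ_mul p q : semidirectZ alpha :=
  (p.1 * autz alpha p.2 q.1, (p.2 + q.2)%R).
Definition semidirectZ_inv p : semidirectZ alpha :=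
  (autz alpha (- p.2)%R p.1^-1, (- p.2)%R).

Lemma semidirectZ_mulA : associative semidirectZ_mul.
Proof.
move=> [k m] [l n] [h r]; congr pair => /=; last exact: addrA.
by rewrite autzM mulgA autzD.
Qed.

Lemma semidirectZ_mul1g : left_id semidirectZ_one semidirectZ_mul.
Proof. by case=> k m; congr pair; rewrite /= ?mul1g ?add0r. Qed.

Lemma semidirectZ_mulg1 : right_id semidirectZ_one semidirectZ_mul.
Proof. by case=> k m; congr pair; rewrite /= ?autz1 ?mulg1 ?addr0. Qed.

Lemma semidirectZ_mulVg :
  left_inverse semidirectZ_one semidirectZ_inv semidirectZ_mul.
Proof. by case=> k m; congr pair; rewrite /= ?addNr // -autzM mulVg autz1. Qed.

Lemma semidirectZ_mulgV :
  right_inverse semidirectZ_one semidirectZ_inv semidirectZ_mul.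
Proof.
by case=> k m; congr pair; rewrite /= ?addrN // -autzD addrN /autz /= mulgV.
Qed.

HB.instance Definition _ := isGroup.Build (semidirectZ alpha)
  semidirectZ_mulA semidirectZ_mul1g semidirectZ_mulg1
  semidirectZ_mulVg semidirectZ_mulgV.

Definition sd_base (k : K) : semidirectZ alpha := (k, 0%R).
Definition sd_stable : semidirectZ alpha := (1, 1%R).

Lemma sd_relation k :
  sd_stable * sd_base k * sd_stable^-1 = sd_base (alpha k).
Proof.
suff -> : sd_stable * sd_base k = sd_base (alpha k) * sd_stable by rewrite mulgK.
by congr pair => //=; rewrite mul1g mulg1.
Qed.

Lemma sd_baseM k l : sd_base (k * l) = sd_base k * sd_base l.
Proof. by []. Qed.

(* [semidirectZ alpha] has the presentation < K, t | t k t^-1 = alpha k >. *)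
Lemma sd_presentation (H : groupType) (phi : {multiplicative K -> H}) (y : H) :
  (forall k, y * phi k * y^-1 = phi (alpha k)) ->
  exists2 f : {multiplicative semidirectZ alpha -> H},
    (forall k, f (sd_base k) = phi k) /\ f sd_stable = y &
    forall g : {multiplicative semidirectZ alpha -> H},
      (forall k, g (sd_base k) = phi k) -> g sd_stable = y -> g =1 f.
Proof.
move=> yphi.
have phi1 : phi 1 = 1 by apply: (@mulgI _ (phi 1)); rewrite -gmulfM !mulg1.
have yphiV k : y^-1 * phi k = phi (aut_inv alpha k) * y^-1.
  by rewrite -{1}(aut_invK alpha k) -yphi !mulgA mulVg mul1g.
have yzphi m k : zexpg y m * phi k = phi (autz alpha m k) * zexpg y m.
  rewrite -[zexpg y m in RHS]mulg1 !zexpg_iterz /autz; case: m => n /=.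
    elim: n k => [|n IHn] k /=; first by rewrite mulg1.
    by rewrite IHn !mulgA -yphi mulgVK.
  rewrite -!iterS; elim: n.+1 => {n} [|n IHn] /=; first by rewrite mulg1.
  by rewrite IHn !mulgA yphiV.
pose f (p : semidirectZ alpha) := phi p.1 * zexpg y p.2.
have fM : {morph f : p q / p * q}.
  move=> [k m] [l n]; rewrite /f /= gmulfM zexpgD -!mulgA; congr (_ * _).
  by rewrite !mulgA yzphi.
pose F : {multiplicative semidirectZ alpha -> H} :=
  HB.pack f (isMultiplicative.Build _ _ f fM).
exists F; first by split=> [k|]; rewrite /F /= /f /= ?phi1 ?mulg1 ?mul1g.
move=> g gphi gy; pose t m : semidirectZ alpha := (1, m).
have gt m : g (t m) = zexpg y m.
  apply: (eq_zexpg (f := g \o t)) => // {}m n; rewrite /= -gmulfM; congr (g _).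
  by congr pair; rewrite /= autz1 mulg1.
move=> [k m]; rewrite /F /= /f /= -gphi -gt -gmulfM; congr (g _).
by rewrite /t; congr pair; rewrite /= ?mulg1 ?add0r.
Qed.

End SemidirectZ.

Definition infinite_cyclic : groupType := Algebra.to_multiplicative int.

Lemma inversionZ_subproof :
  {morph (fun x : infinite_cyclic => x^-1) : x y / x * y}.
Proof. exact: opprD. Qed.

Definition inversionZ : automorphism infinite_cyclic :=
  @Automorphism infinite_cyclic
    (HB.pack (fun x : infinite_cyclic => x^-1)
       (isMultiplicative.Build infinite_cyclic infinite_cyclic
          (fun x => x^-1) inversionZ_subproof))
    (fun x => x^-1) (@invgK _) (@invgK _).

Definition klein_bottle_group : groupType := semidirectZ inversionZ.

Definition klein_a : klein_bottle_group :=
  sd_base inversionZ (1%R : int).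
Definition klein_t : klein_bottle_group := sd_stable inversionZ.

Lemma klein_relation : klein_t * klein_a * klein_t^-1 = klein_a^-1.
Proof. exact: sd_relation. Qed.

(* [klein_bottle_group] has the presentation < a, t | t a t^-1 = a^-1 >. *)
Lemma klein_presentation (H : groupType) (x y : H) : y * x * y^-1 = x^-1 ->
  exists2 f : {multiplicative klein_bottle_group -> H},
    f klein_a = x /\ f klein_t = y &
    forall g : {multiplicative klein_bottle_group -> H},
      g klein_a = x -> g klein_t = y -> g =1 f.
Proof.
move=> yx; pose phi : {multiplicative infinite_cyclic -> H} :=
  HB.pack (zexpg x : infinite_cyclic -> H)
    (isMultiplicative.Build infinite_cyclic H (zexpg x) (zexpgD x)).
have yphi k : y * phi k * y^-1 = phi (inversionZ k).
  transitivity (zexpg x^-1 k).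
    apply: (eq_zexpg (f := fun m => y * zexpg x m * y^-1)) => [m n|//].
    by rewrite zexpgD !mulgA mulgVK.
  apply/esym/(eq_zexpg (f := fun m => zexpg x (- m)%R)) => // m n.
  by rewrite opprD zexpgD.
have [f [fphi ft] f_uniq] := sd_presentation yphi.
exists f => [|g ga gt]; first by split=> //; exact: fphi.
apply: f_uniq => // k; apply: (eq_zexpg (f := g \o sd_base inversionZ)) => //.
by move=> m n; rewrite /= -gmulfM.
Qed.

(* Main.v *)
From HB Require Import structures.
Require Import Defs.
From mathcomp Require Import all_boot all_order all_algebra finmap.
From mathcomp Require Import all_classical all_reals all_analysis.
From mathcomp Require Import ring zify.

(** Let [A] be a finite generating set of [S], and [B] the set of commutators
    [[x, y]] of elements of [A] together with their conjugates by elements of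
    [A]: words of length at most 6 in the kernel [K] of the projection to [Z].
    If [<B>] is not cyclic, then [omega(S, A) >= u^(1/6)].

    If [<B> = <c>], let [h <> 1] be a commutator of generators and [a] in [A].
    As [h] and [a^-1 h a] are powers of [c], there are coprime [p], [q] with
    [h^q = (a^-1 h a)^p].  If [p] and [q] are not both [1] or [-1], then
    [h a^-1] and [a^-1] generate a free semigroup, whence
    [omega(S, A) >= 2^(1/5)].  Otherwise every generator centralizes or inverts
    every such [h].  Suppose that [S] is not abelian.  The subgroups of [K] being cyclic as soon as they are
    finitely generated and abelian, all elements of [S] in [K] are then
    commensurable with [h]; it follows that they commute, and that each element
    of [S] either centralizes them all or inverts them all.  Hence [S] is
    generated by [S] meet [K], which is cyclic, and one more element. *)

Set Implicit Arguments.
Unset Strict Implicit.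
Unset Printing Implicit Defensive.

Import Order.TTheory GRing.Theory Num.Theory.
Import numFieldNormedType.Exports.

Local Open Scope classical_set_scope.

(** * Powers and generated subgroups *)

Section IntegerPowers.
Local Open Scope group_scope.
Variable G : groupType.
Implicit Types (x y a : G) (m n : int).

Lemma zexpgM x m n : zexpg x (m * n)%R = zexpg (zexpg x m) n.
Proof.
apply: (eq_zexpg (f := fun n => zexpg x (m * n)%R)) => [i j|].
  by rewrite mulrDr zexpgD.
by rewrite mulr1.
Qed.

Lemma zexpgJ x a m : zexpg x m ^ a = zexpg (x ^ a) m.
Proof.
by apply: (eq_zexpg (f := fun m => zexpg x m ^ a)) => // i j; rewrite zexpgD conjMg.
Qed.

Lemma zexp1g m : zexpg (1 : G) m = 1.
Proof. by apply/esym/(eq_zexpg (f := fun=> 1)) => // i j; rewrite mulg1. Qed.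

Lemma zexpVg x m : zexpg x^-1 m = (zexpg x m)^-1.
Proof. by case: m => n /=; rewrite expVgn. Qed.

Lemma commute_zexpg x y m : commute x y -> commute x (zexpg y m).
Proof.
by move=> cxy; case: m => n /=; [|apply: commuteV]; apply: commuteX.
Qed.

Lemma zexpgMn x y m : commute x y ->
  zexpg (x * y) m = zexpg x m * zexpg y m.
Proof.
move=> cxy; apply/esym.
apply: (eq_zexpg (f := fun m => zexpg x m * zexpg y m)) => // i j.
rewrite !zexpgD -!mulgA; congr (_ * _); rewrite !mulgA; congr (_ * _).
by apply: commute_sym; apply: commute_zexpg; apply: commute_sym;
  apply: commute_zexpg.
Qed.

(** A Bezout relation writes [x] as a product of powers of [x ^ m] and [x ^ n]. *)
Lemma zexpg_bezout x m n (P : set G) : is_subgroup P -> coprimez m n ->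
  P (zexpg x m) -> P (zexpg x n) -> P x.
Proof.
move=> [_ PM PV] /coprimezP [[i j] /= ij] Pm Pn.
have PX y k : P y -> P (zexpg y k).
  move=> Py; have Pn' (l : nat) : P (y ^+ l.+1).
    by elim: l => // l IHl; rewrite expgS; apply: PM.
  case: k => [[|l]|l]; last exact: PV; last exact: Pn'.
  by rewrite /= expg0 -(mulgV y); apply: PM => //; apply: PV.
have -> : x = zexpg (zexpg x m) i * zexpg (zexpg x n) j.
  by rewrite -!zexpgM -zexpgD mulrC [(n * j)%R]mulrC ij.
by apply: PM; apply: PX.
Qed.

Hypothesis G_tf : torsion_free G.

Lemma zexpg_eq1 x m : zexpg x m = 1 -> m = 0%R \/ x = 1.
Proof.
case: m => [[|n]|n] /=; first by left.
  by move=> xn; right; apply: (@G_tf x n.+1).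
by move=> xn; right; apply: (@G_tf x n.+1) => //; apply: invg_inj; rewrite xn invg1.
Qed.

Lemma zexpg_inj x : x <> 1 -> injective (zexpg x).
Proof.
move=> x1 m n mn; apply/eqP; rewrite -subr_eq0; apply/eqP.
have mn1 : zexpg x (m - n)%R = 1 by rewrite zexpgD zexpgN mn mulgV.
by have [|/x1] := zexpg_eq1 mn1.
Qed.

(** Uniqueness of roots among commuting elements: the [m]-th power of [x / y] is trivial. This lifts
    conjugation relations from powers to the elements themselves. *)
Lemma zexpIg x y m : m <> 0%R -> commute x y -> zexpg x m = zexpg y m -> x = y.
Proof.
move=> m0 cxy xy; have xy1 : zexpg (x / y) m = 1.
  by rewrite zexpgMn ?zexpVg ?xy ?mulgV //; apply: commuteV.
by have [/m0|/divg1_eq] := zexpg_eq1 xy1.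
Qed.

End IntegerPowers.

Section GeneratedSubgroups.
Local Open Scope group_scope.
Variable G : groupType.
Implicit Types (A B P : set G) (x y a : G).

Lemma generated_subgroup A : is_subgroup (generated A).
Proof.
split=> [P [[] //]|x y Ax Ay P PA|x Ax P PA]; have [[_ PM PV] _] := PA.
  by apply: PM; [apply: Ax|apply: Ay].
by apply: PV; apply: Ax.
Qed.

Lemma sub_generated A : A `<=` generated A.
Proof. by move=> x Ax P [_]; apply. Qed.

Lemma generated_sub A P : is_subgroup P -> A `<=` P -> generated A `<=` P.
Proof. by move=> Pg AP x; apply. Qed.

Lemma subgroup_zexpg P x m : is_subgroup P -> P x -> P (zexpg x m).
Proof.
move=> [P1 PM PV] Px; have Pn (n : nat) : P (x ^+ n).
  by elim: n => // n IHn; rewrite expgS; apply: PM.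
by case: m => n; [apply: Pn|apply: PV].
Qed.

Lemma zexpg_subgroup x : is_subgroup (range (zexpg x)).
Proof.
split=> [|_ _ [i _ <-] [j _ <-]|_ [i _ <-]]; first by exists 0%R.
  by exists (i + j)%R => //; rewrite zexpgD.
by exists (- i)%R => //; rewrite zexpgN.
Qed.

Lemma generated1 x : generated [set x] = range (zexpg x).
Proof.
apply/seteqP; split.
  apply: generated_sub; first exact: zexpg_subgroup.
  by move=> _ ->; exists 1%R.
move=> _ [i _ <-]; apply: (subgroup_zexpg i (generated_subgroup _)).
exact: sub_generated.
Qed.

Lemma subgroupJ P x a : is_subgroup P -> P x -> P a -> P (x ^ a).
Proof. by move=> [_ PM PV] Px Pa; apply: (PM _ _ (PV _ Pa) (PM _ _ Px Pa)). Qed.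

Lemma commutes_subgroup A : is_subgroup [set x | forall y, A y -> commute x y].
Proof.
split=> [y _|x z cx cz y Ay|x cx y Ay] /=; first exact/commute_sym/commute1.
  by apply/commute_sym/commuteM; apply/commute_sym; [exact: cx|exact: cz].
by apply/commute_sym/commuteV/commute_sym; exact: cx.
Qed.

Lemma commute_generated A x y :
  (forall z, A z -> commute x z) -> generated A y -> commute x y.
Proof.
move=> cxA /(generated_sub (commutes_subgroup [set x])) Ay; apply/commute_sym.
by apply: Ay => // z Az _ ->; apply/commute_sym/cxA.
Qed.

Lemma conjg_preimage_subgroup P a : is_subgroup P -> is_subgroup [set x | P (x ^ a)].
Proof.
move=> [P1 PM PV]; split=> [|x y|x] /=; first by rewrite conj1g.
  by rewrite conjMg; apply: PM.
by rewrite conjVg; apply: PV.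
Qed.

Lemma generated_abelian A : (forall x y, A x -> A y -> commute x y) ->
  forall x y, generated A x -> generated A y -> commute x y.
Proof.
move=> cA x y Ax; apply: commute_generated => z Az.
by apply/commute_sym; apply: commute_generated Ax => w Aw; apply: cA.
Qed.

(** The elements of the abelian group [generated A] whose [n]-th power is a power of [x ^ m] form a
    subgroup. Containing [A], it contains [x], whose exponents are unique. *)
Lemma dvdz_exponent A x (m n : int) : torsion_free G -> x <> 1 ->
    (forall y z, A y -> A z -> commute y z) ->
    (forall y, A y -> exists i, zexpg y n = zexpg x (m * i)%R) ->
  generated A x -> (m %| n)%Z.
Proof.
move=> G_tf x1 cA Amn Ax; have [A1 AM AV] := generated_subgroup A.
pose P := [set y | generated A y /\ exists i, zexpg y n = zexpg x (m * i)%R].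
have Pg : is_subgroup P.
  split=> [|y z [Ay [i yi]] [Az [j zj]]|y [Ay [i yi]]].
  - by split=> //; exists 0%R; rewrite mulr0 zexp1g.
  - split; first exact: AM.
    exists (i + j)%R; rewrite zexpgMn ?yi ?zj; first by rewrite mulrDr zexpgD.
    exact: generated_abelian Ay Az.
  - split; first exact: AV.
    by exists (- i)%R; rewrite zexpVg yi mulrN zexpgN.
have [|_ [i /(zexpg_inj G_tf x1) ->]] := generated_sub Pg _ Ax.
  by move=> y Ay; split; [exact: sub_generated|exact: Amn].
exact: dvdz_mulr.
Qed.

End GeneratedSubgroups.

(** * Free semigroups *)

Section FreeSemigroup.
Local Open Scope group_scope.
Variables (G : groupType) (x a : G) (p q : int).
Hypotheses (G_tf : torsion_free G) (x_neq1 : x <> 1) (co_pq : coprimez p q)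
  (pq : zexpg x q = zexpg (x ^ a) p).

Let k i := x ^ (a ^+ i).

Let kJ i : k i ^ a = k i.+1.
Proof. by rewrite /k -conjgM -expgSr. Qed.

Let k_eq i : zexpg (k i) q = zexpg (k i.+1) p.
Proof. by rewrite /k expgS conjgM -zexpgJ pq zexpgJ. Qed.

Let kD i m : zexpg (k i) (q ^+ m)%R = zexpg (k (i + m)) (p ^+ m)%R.
Proof.
elim: m => [|m IHm]; first by rewrite addn0.
by rewrite exprSr zexpgM IHm -zexpgM mulrC zexpgM k_eq -zexpgM -exprS addnS.
Qed.

Let kVJ i : k i.+1 ^ a^-1 = k i.
Proof. by rewrite -kJ conjgK. Qed.

(* The centralizer [C] of [k 0, ..., k n] is normalized by [a], and contains
   [k 0 ^ (q ^ n) = k n ^ (p ^ n)], hence also its conjugate [k 0 ^ (p ^ n)].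
   So it contains [k 0] by Bezout, and the [k i] commute. *)
Lemma conjugates_unit_exponents n :
  generated [set k i | i in [set i | (0 < i <= n)%N]] (k 0) ->
  generated [set k i | i in [set i | (i < n)%N]] (k n) ->
  `|p|%N = 1%N /\ `|q|%N = 1%N.
Proof.
move=> k0_gen kn_gen.
pose C : set G := [set g | forall y, [set k i | i in [set i | (i <= n)%N]] y ->
  commute g y].
have Cg : is_subgroup C := commutes_subgroup _.
have CE g : C g <-> forall i, (i <= n)%N -> commute g (k i).
  by split=> [Cg' i ilen|cg _ [i ilen <-]]; [apply: Cg'; exists i|apply: cg].
(* Conjugation by [a] shifts indices, so [g ^ a] commutes with [k 1], ..., [k n], hence with [k 0],
   which lies in the subgroup they generate. *)
have CJ g : C g -> C (g ^ a).
  move=> /CE cg; have cgS i : (0 < i <= n)%N -> commute (g ^ a) (k i).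
    case: i => // i iltn; rewrite -kJ /commute -!conjMg.
    by congr (_ ^ _); apply: cg; apply: ltnW.
  apply/CE => -[|i] ilen; last exact: cgS.
  by apply: commute_generated k0_gen => _ [i ilt <-]; apply: cgS.
have CVJ g : C g -> C (g ^ a^-1).
  move=> /CE cg; have cgP i : (i < n)%N -> commute (g ^ a^-1) (k i).
    by move=> iltn; rewrite -kVJ /commute -!conjMg; congr (_ ^ _); apply: cg.
  apply/CE => i; rewrite leq_eqVlt => /orP[/eqP->|]; last exact: cgP.
  by apply: commute_generated kn_gen => _ [j jlt <-]; apply: cgP.
have CXJ g i : C g -> C (g ^ (a ^+ i)).
  by move=> Cg'; elim: i => [|i IHi]; rewrite ?conjg1 // expgSr conjgM; apply: CJ.
have CXVJ g i : C g -> C (g ^ (a ^- i)).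
  move=> Cg'; elim: i => [|i IHi]; first by rewrite invg1 conjg1.
  by rewrite expgS invgM conjgM; apply: CVJ.
(* By [kD] this element is a power of each [k i], namely [(k i ^ (p ^ i)) ^ (q ^ (n - i))]. *)
have Cz : C (zexpg (k 0) (q ^+ n)%R).
  apply/CE => i ilen; rewrite -{1}(subnKC ilen) exprD zexpgM kD add0n.
  exact/commute_sym/commute_zexpg/commute_zexpg.
have Ck0 : C (k 0).
  apply: (@zexpg_bezout _ (k 0) (p ^+ n)%R (q ^+ n)%R C Cg).
  - by apply: coprimezXl; apply: coprimezXr.
  - by have := CXVJ _ n Cz; rewrite kD add0n zexpgJ -conjgM mulgV.
  - exact: Cz.
have Ck i : C (k i) by have := CXJ _ i Ck0; rewrite {1}/k expg0 conjg1.
have dvd1 (r s : int) : coprimez r s -> (r %| s)%Z -> `|r|%N = 1%N.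
  by rewrite coprimezE dvdzE => /eqP rs /gcdn_idPl; rewrite rs.
have k1 i : k i <> 1 by move/eqP; rewrite conjg_eq1 => /eqP.
(* For [i < n], [k i ^ (q ^ n)] is the power of [k n] with exponent [p ^ (n - i) * q ^ i], a
   multiple of [p]. As these [k i] generate a group containing [k n], [p] divides [q ^ n] and is a
   unit by coprimality. The argument for [q] is symmetric. *)
split.
  apply: (dvd1 _ (q ^+ n)%R); first exact: coprimezXr.
  apply: (dvdz_exponent G_tf (k1 n) _ _ kn_gen) => [_ _ [i _ <-] [j jn <-]|].
    by have /CE := Ck i; apply; apply: ltnW.
  move=> _ [i /= iltn <-]; exists (p ^+ (n - i.+1) * q ^+ i)%R.
  rewrite mulrA -exprS -subSn // subSS.
  rewrite -{1}(subnK (ltnW iltn)) exprD zexpgM kD subnKC 1?ltnW //.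
  by rewrite -zexpgM.
apply: (dvd1 _ (p ^+ n)%R); first by rewrite coprimez_sym; exact: coprimezXl.
apply: (dvdz_exponent G_tf (k1 0) _ _ k0_gen) => [_ _ [i _ <-] [j /andP[_ jn] <-]|].
  by have /CE := Ck i; apply.
move=> _ [[//|i] /= iltn <-]; exists (q ^+ i * p ^+ (n - i.+1))%R.
by rewrite mulrA -exprS zexpgM kD add0n -zexpgM -exprD subnKC.
Qed.

(** What remains of a word in [x * a^-1] and [a^-1] once all [a^-1] are collected at its right end:
    the product of the [k i ^+ b_i] by increasing [i], with [b_i] the letter at place [i]. *)
Definition twisted_word (s : seq bool) : G :=
  foldr (fun (b : bool) w => x ^+ b * w ^ a) 1 s.

Lemma twisted_wordE (s : seq bool) :
  \prod_(b <- s) (x ^+ b * a^-1 : G) = twisted_word s * a ^- size s.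
Proof.
elim: s => [|b s IHs]; first by rewrite big_nil invg1 mulg1.
by rewrite big_cons IHs /= conjgE expgSr invgM !mulgA mulgK.
Qed.

Lemma twisted_word_rcons s b :
  twisted_word (rcons s b) = twisted_word s * k (size s) ^+ b.
Proof.
elim: s => [|c s IHs] /=; first by rewrite conj1g mulg1 mul1g /k conjg1.
by rewrite IHs conjMg conjXg kJ mulgA.
Qed.

Lemma twisted_word_gen s :
  generated [set k i | i in [set i | (i < size s)%N]] (twisted_word s).
Proof.
elim/last_ind: s => [|s b IHs]; first by move=> P [[]].
have [P1 PM _] := generated_subgroup
  [set k i | i in [set i | (i < size (rcons s b))%N]].
rewrite twisted_word_rcons size_rcons; rewrite size_rcons in P1 PM; apply: PM.
  apply: (generated_sub (generated_subgroup _) _ IHs) => _ [i ilt <-].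
  by apply: sub_generated; exists i => //; apply: ltnW.
case: b; last exact: P1.
by apply: sub_generated; exists (size s) => //=.
Qed.

Lemma twisted_wordJ_gen s :
  generated [set k i | i in [set i | (0 < i <= size s)%N]] (twisted_word s ^ a).
Proof.
set B := [set k i | i in _].
have Bg := conjg_preimage_subgroup a (generated_subgroup B).
apply: (generated_sub Bg _ (@twisted_word_gen s)) => _ [i ilt <-] /=.
by apply: sub_generated; rewrite kJ; exists i.+1.
Qed.

Hypothesis pq_nonunit : ~ (`|p|%N = 1%N /\ `|q|%N = 1%N).

(** Words of equal length carry the same power of [a], so this separates the words of a given length
    in [x * a^-1] and [a^-1], which is enough for counting them. *)
Lemma twisted_word_inj s t :
  size s = size t -> twisted_word s = twisted_word t -> s = t.
Proof.
have [n] := ubnP (size s); elim: n s t => // n IHn [|b s] [|c t] //= slen [st].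
(* Two distinct words of minimal length with the same value differ in both
   their first and their last letters. *)
have [<-|bc] := eqVneq b c; first by move=> /mulgI/conjg_inj /IHn ->.
move=> bst; have cst : twisted_word (b :: s) = twisted_word (c :: t) := bst.
move: cst; rewrite !lastI !twisted_word_rcons !size_belast -st.
have [->|de] := eqVneq (last b s) (last c t).
  by move=> /mulIg /IHn -> //; rewrite ?size_belast.
move=> cst; case: pq_nonunit; apply: (@conjugates_unit_exponents (size s)).
  have := @twisted_wordJ_gen s; have := @twisted_wordJ_gen t; rewrite -st.
  have := generated_subgroup [set k i | i in [set i | (0 < i <= size s)%N]].
  move: (generated _) => P [_ PM PV] Pt Ps; rewrite {1}/k expg0 conjg1.
  case: b c bc bst {cst de} => [] [] //= _; rewrite mul1g ?expg1 => xst.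
    by rewrite -[x](mulgK (twisted_word s ^ a)) xst; apply: PM => //; apply: PV.
  by rewrite -[x](mulgK (twisted_word t ^ a)) -xst; apply: PM => //; apply: PV.
have := @twisted_word_gen (belast b s); have := @twisted_word_gen (belast c t).
rewrite !size_belast -st.
have := generated_subgroup [set k i | i in [set i | (i < size s)%N]].
move: (generated _) => P [_ PM PV] Pt Ps.
case: (last b s) (last c t) de cst => [] [] //= _; rewrite mulg1 ?expg1 => xst.
  rewrite -[k _](mulKg (twisted_word (belast b s))) xst.
  by apply: PM => //; apply: PV.
rewrite -[k _](mulKg (twisted_word (belast c t))) -xst.
by apply: PM => //; apply: PV.
Qed.

End FreeSemigroup.

(** * Growth rates *)

Section Fekete.
Local Open Scope ring_scope.
Variables (R : realType) (a : nat -> R).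
Hypotheses (a_ge0 : forall n, 0 <= a n) (aD : forall m n, a (m + n)%N <= a m + a n).

Let slopes := [set a n.+1 / n.+1%:R | n in [set: nat]].

Lemma slopes_lbound0 : lbound slopes 0.
Proof. by move=> _ [n _ <-]; rewrite divr_ge0. Qed.

Lemma inf_slopes_le n : inf slopes * n%:R <= a n.
Proof.
case: n => [|n]; first by rewrite mulr0.
rewrite -ler_pdivlMr ?ltr0Sn //; apply: ge_inf; last by exists n.
by exists 0; exact: slopes_lbound0.
Qed.

Lemma subadditive_muln (q m r : nat) : a (q * m + r)%N <= a m *+ q + a r.
Proof.
elim: q => [|q IHq]; first by rewrite add0r.
rewrite mulSn -addnA mulrS -addrA; apply: le_trans (aD _ _) _.
by rewrite lerD2l.
Qed.

(** Choose a slope [a m.+1 / m.+1] within [e / 2] of the infimum and divide [n] by [m.+1]: the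
    remainder contributes a bounded amount, negligible against [n]. *)
Lemma subadditive_cvg : a n / n%:R @[n --> \oo] --> inf slopes.
Proof.
apply/cvgrPdist_le => e e_gt0; have e2 : 0 < e / 2 by rewrite divr_gt0.
have [|_ [m _ <-] am] := inf_adherent e2 (E := slopes).
  split; first by exists (a 1 / 1); exists 0.
  by exists 0; exact: slopes_lbound0.
(* The terms being nonnegative, [C] bounds [a] at every remainder modulo [m.+1]. *)
pose C := \sum_(i < m.+1) a i.
near=> n; have n_gt0 : 0 < n%:R :> R by rewrite ltr0n; near: n; exact: nbhs_infty_gt.
have nC : C <= e / 2 * n%:R.
  rewrite mulrC -ler_pdivrMr //; near: n; exact: nbhs_infty_ger.
rewrite distrC ger0_norm ?subr_ge0 ?ler_pdivlMr ?inf_slopes_le //.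
rewrite lerBlDr ler_pdivrMr // (divn_eq n m.+1).
apply: le_trans (subadditive_muln _ _ _) _; rewrite -divn_eq.
have a_mod : a (n %% m.+1)%N <= C.
  by rewrite /C (bigD1 (Ordinal (ltn_pmod n (ltn0Sn m)))) //= lerDl sumr_ge0.
have a_div : a m.+1 *+ (n %/ m.+1) <= a m.+1 / m.+1%:R * n%:R.
  rewrite -[leLHS]mulr_natr -mulrA ler_wpM2l // [leRHS]mulrC ler_pdivlMr ?ltr0Sn //.
  by rewrite -natrM ler_nat leq_divM.
have am_n : a m.+1 / m.+1%:R * n%:R <= (inf slopes + e / 2) * n%:R.
  by rewrite ler_pM2r // ltW.
apply: le_trans (lerD (le_trans a_div am_n) (le_trans a_mod nC)) _.
by rewrite -mulrDl -addrA -splitr addrC.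
Unshelve. all: by end_near. Qed.

End Fekete.

(** * Word balls and their cardinalities *)

Section WordBalls.
Local Open Scope group_scope.
Variable G : groupType.
Implicit Types (A B : set G) (x y : G).

Lemma word_ball1 A n : word_ball A n 1.
Proof. by exists [::]; split; rewrite ?big_nil. Qed.

Lemma word_ball_letter A x : A x -> word_ball A 1 x.
Proof.
move=> Ax; exists [:: x]; rewrite big_seq1; split=> // y.
by rewrite inE => /eqP ->; left.
Qed.

Lemma word_ballM A m n x y : word_ball A m x -> word_ball A n y ->
  word_ball A (m + n) (x * y).
Proof.
move=> [s [ms As ->]] [t [nt At ->]]; exists (s ++ t).
rewrite size_cat leq_add // big_cat; split=> // z.
by rewrite mem_cat => /orP[/As|/At].
Qed.

Lemma word_ballV A n x : word_ball A n x -> word_ball A n x^-1.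
Proof.
move=> [s [ms As ->]]; exists [seq z^-1 | z <- rev s].
rewrite size_map size_rev big_map prodgV revK; split=> // y /mapP[z].
by rewrite mem_rev => /As Az ->; rewrite invgK; case: Az; [right|left].
Qed.

Lemma word_ballR A x y : A x -> A y -> word_ball A 4 [~ x, y].
Proof.
move=> /word_ball_letter Ax /word_ball_letter Ay.
rewrite commgEl conjgE; apply: (@word_ballM _ 1 3); first exact: word_ballV.
by apply: (@word_ballM _ 1 2); [exact: word_ballV|exact: (@word_ballM _ 1 1)].
Qed.

Lemma word_ballJ A n x y : word_ball A n x -> A y -> word_ball A n.+2 (x ^ y).
Proof.
move=> Ax /word_ball_letter Ay; rewrite conjgE -add1n.
apply: word_ballM; first exact: word_ballV.
by rewrite -addn1; apply: word_ballM.
Qed.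

Lemma word_ball_comp A B d n x : B `<=` word_ball A d -> word_ball B n x ->
  word_ball A (d * n) x.
Proof.
move=> BA [s [sn Bs ->]].
have [r ->] : exists r, (d * n)%N = (d * size s + r)%N.
  by exists (d * n - d * size s)%N; rewrite subnKC // leq_mul2l sn orbT.
rewrite -[X in word_ball _ _ X]mulg1; apply: word_ballM; last exact: word_ball1.
elim: s Bs {sn} => [|y s IHs] Bs; first by rewrite big_nil; exact: word_ball1.
rewrite big_cons mulnS; apply: word_ballM.
  have [/BA//|/BA/word_ballV] := Bs y (mem_head _ _).
  by rewrite invgK.
by apply: IHs => z zs; apply: Bs; rewrite inE zs orbT.
Qed.

Lemma growth_function_gt0 A n : finite_set A -> (0 < growth_function A n)%N.
Proof.
move=> finA; rewrite cardfs_gt0; apply/fset0Pn; exists 1.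
by rewrite in_fset_set ?inE; [exact: word_ball1|exact: finite_word_ball].
Qed.

Lemma mem_word_ball A n x : finite_set A ->
  (x \in fset_set (word_ball A n)) = `[< word_ball A n x >].
Proof.
by move=> finA; rewrite in_fset_set ?asboolE //; exact: finite_word_ball.
Qed.

Lemma growth_function_le_size A n (s : seq G) : finite_set A ->
  (forall x, word_ball A n x -> x \in s) -> (growth_function A n <= size s)%N.
Proof.
move=> finA As; apply: uniq_leq_size (fset_uniq _) _ => x.
by rewrite mem_word_ball // => /asboolP /As.
Qed.

Lemma size_le_growth_function A n (s : seq G) : finite_set A -> uniq s ->
  (forall x, x \in s -> word_ball A n x) -> (size s <= growth_function A n)%N.
Proof.
move=> finA uniq_s As; apply: uniq_leq_size uniq_s _ => x /As Ax.
by rewrite mem_word_ball //; apply/asboolP.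
Qed.

(** A word of length at most [m + n] is cut after its first [m] letters. *)
Lemma growth_functionD A m n : finite_set A ->
  (growth_function A (m + n) <= growth_function A m * growth_function A n)%N.
Proof.
move=> finA; rewrite /growth_function -(size_allpairs *%g).
apply: growth_function_le_size => // _ [s [smn As ->]].
rewrite -(cat_take_drop m s) big_cat; apply: allpairs_f; rewrite mem_word_ball //.
  apply/asboolP; exists (take m s); split=> // [|x /mem_take /As //].
  by rewrite size_take_min geq_minl.
apply/asboolP; exists (drop m s); split=> // [|x /mem_drop /As //].
by rewrite size_drop leq_subLR.
Qed.

Lemma growth_functionX A d n : finite_set A -> (0 < d)%N ->
  (growth_function A (d * n) <= growth_function A n ^ d)%N.
Proof.
move=> finA; case: d => // d _; elim: d => [|d IHd]; first by rewrite mul1n.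
rewrite mulSn expnS; apply: leq_trans (growth_functionD _ _ finA) _.
by rewrite leq_mul2l IHd orbT.
Qed.

End WordBalls.

Lemma leq_growth_function (G H : groupType) (f : G -> H) (A : set G) (B : set H)
    m n : finite_set A -> finite_set B -> injective f ->
  (forall x, word_ball A m x -> word_ball B n (f x)) ->
  (growth_function A m <= growth_function B n)%N.
Proof.
move=> finA finB f_inj ABf; rewrite /growth_function -(size_map f).
apply: size_le_growth_function => //; first by rewrite map_inj_uniq ?fset_uniq.
by move=> _ /mapP[x xA ->]; apply: ABf; rewrite mem_word_ball // in xA; apply/asboolP.
Qed.

(** * Polynomial growth of abelian groups *)

Section AbelianGrowth.
Local Open Scope group_scope.
Variable G : groupType.
Implicit Types (s w : seq G).

(** Normal forms in an abelian group, with exponents between [-n] and [n]; the shift by [n] lets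
    [iota] enumerate them. *)
Fixpoint power_box n s : seq G :=
  if s is x :: s' then
    [seq zexpg x (i%:Z - n%:Z)%R * y | i <- iota 0 (n + n).+1, y <- power_box n s']
  else [:: 1].

Lemma size_power_box n s : size (power_box n s) = ((n + n).+1 ^ size s)%N.
Proof.
elim: s => // x s IHs; rewrite expnS -IHs -[X in (X * _)%N](size_iota 0).
exact: size_allpairs.
Qed.

Lemma power_box_consP n x s z :
  reflect (exists e y, [/\ (`|e| <= n)%N, y \in power_box n s & z = zexpg x e * y])
          (z \in power_box n (x :: s)).
Proof.
apply: (iffP allpairsP) => [[[i y] [i_n sy ->]]|[e [y [e_n sy ->]]]].
  by exists (i%:Z - n%:Z)%R, y; split=> //; move: i_n; rewrite mem_iota /=; lia.
exists (absz (e + n%:Z)%R, y); split; last by congr (zexpg _ _ * _) => /=; lia.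
  by rewrite mem_iota /=; lia.
exact: sy.
Qed.

Lemma power_box1 n s : 1 \in power_box n s.
Proof.
elim: s => [|x s IHs]; first exact: mem_head.
by apply/power_box_consP; exists 0%R, 1; split=> //; rewrite mulg1.
Qed.

(** A letter from the tail of the list moves past the leading power and is handled by induction; the
    leading letter or its inverse changes the leading exponent by one. *)
Lemma power_boxM n s x y : (forall z t, z \in s -> t \in s -> commute z t) ->
    x \in s \/ x^-1 \in s -> y \in power_box n s -> x * y \in power_box n.+1 s.
Proof.
elim: s y => [|z s IHs] y cs xs; first by case: xs.
move=> /power_box_consP[e [t [e_n st ->]]]; apply/power_box_consP.
have cs' z' t' : z' \in s -> t' \in s -> commute z' t'.
  by move=> z's t's; apply: cs; exact: mem_behead.
have sub v : v \in power_box n s -> v \in power_box n.+1 s.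
  move=> {xs IHs st cs cs'}; elim: s v => // w s IHs v /power_box_consP[f [u [fn su ->]]].
  by apply/power_box_consP; exists f, u; split; [exact: leqW|exact: IHs|].
have [xs' | xz] : (x \in s \/ x^-1 \in s) \/
    exists2 d : int, (`|d| <= 1)%N & x = zexpg z d.
- case: xs; rewrite inE => /orP[/eqP|xs]; last 1 [by do 2 left|idtac|by left; right].
    by move=> ->; right; exists 1%R.
  by move=> xz; right; exists (-1)%R => //; rewrite /= -xz invgK.
- exists e, (x * t); split; [exact: leqW|exact: IHs|].
  suff cxz : commute x z by rewrite !mulgA; congr (_ * _); exact: commute_zexpg.
  have cz y' : y' \in s -> commute y' z.
    by move=> sy'; apply: cs; rewrite ?mem_head // inE sy' orbT.
  case: xs' => /cz // /commute_sym/commuteV/commute_sym; rewrite invgK //.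
- case: xz => d d1 ->; exists (d + e)%R, t; split; last by rewrite zexpgD mulgA.
    by lia.
  exact: sub.
Qed.

Lemma abelian_growth_function (A : set G) n : finite_set A ->
    (forall x y, A x -> A y -> commute x y) ->
  (growth_function A n <= (n + n).+1 ^ #|` fset_set A|%fset)%N.
Proof.
move=> finA cA; rewrite -size_power_box.
apply: growth_function_le_size => // _ [w [wn Aw ->]].
have AE x : (x \in fset_set A) = `[< A x >] by rewrite in_fset_set ?asboolE.
elim: w n wn Aw => [|x w IHw] n wn Aw; first by rewrite big_nil power_box1.
case: n wn => // n wn; rewrite big_cons; apply: power_boxM.
- by move=> z t; rewrite !AE => /asboolP Az /asboolP; exact: cA.
- by have [Ax|Ax] := Aw x (mem_head _ _); [left|right]; rewrite AE; apply/asboolP.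
- by apply: IHw => // z zw; apply: Aw; rewrite inE zw orbT.
Qed.

End AbelianGrowth.

(** * The growth rate as an infimum *)

Section GrowthRate.
Local Open Scope ring_scope.
Variables (R : realType) (G : groupType) (A : set G).
Hypothesis finA : finite_set A.

Let gamma n : R := (growth_function A n)%:R.

Let gamma_ge1 n : 1 <= gamma n.
Proof. by rewrite ler1n growth_function_gt0. Qed.

Let gamma_gt0 n : 0 < gamma n.
Proof. exact: lt_le_trans (gamma_ge1 n). Qed.

Let ln_gammaD m n : ln (gamma (m + n)) <= ln (gamma m) + ln (gamma n).
Proof.
rewrite -lnM ?posrE // ler_ln ?posrE ?mulr_gt0 //.
by rewrite -natrM ler_nat growth_functionD.
Qed.

Let ln_gamma_ge0 n : 0 <= ln (gamma n).
Proof. exact: ln_ge0. Qed.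

Let rho : R := inf [set ln (gamma n.+1) / n.+1%:R | n in [set: nat]].

(** [limn] is meaningful only for a convergent sequence. Fekete's lemma, applied to the logarithm of
    the submultiplicative [gamma], gives convergence and the value of the limit. *)
Let growth_rateE : growth_rate R A = expR rho.
Proof.
apply/cvg_lim => //.
have cvg_rho : expR (ln (gamma n) / n%:R) @[n --> \oo] --> expR rho.
  apply: continuous_cvg; first exact: continuous_expR.
  exact: (subadditive_cvg ln_gamma_ge0 ln_gammaD).
apply: cvg_trans cvg_rho; apply: near_eq_cvg; near=> n.
by rewrite /powR gt_eqF; [rewrite mulrC|exact: gamma_gt0].
Unshelve. all: by end_near. Qed.

Lemma growth_rate_gt0 : 0 < growth_rate R A.
Proof. by rewrite growth_rateE expR_gt0. Qed.

Lemma growth_rate_expn_le n : growth_rate R A ^+ n <= gamma n.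
Proof.
rewrite growth_rateE -expRM_natr -[leRHS]lnK ?posrE // ler_expR.
exact: (inf_slopes_le (a := fun n => ln (gamma n))).
Qed.

(** From [c ^+ n <= gamma (d * n) <= gamma n ^+ d], the number [ln c / d] is below every slope
    [ln (gamma n) / n], hence below their infimum. *)
Lemma growth_rate_ge (c : R) (d : nat) : 0 < c -> (0 < d)%N ->
  (forall n, c ^+ n <= gamma (d * n)) -> c <= growth_rate R A ^+ d.
Proof.
move=> c_gt0 d_gt0 c_le; rewrite growth_rateE -expRM_natr -[leLHS]lnK ?posrE //.
rewrite ler_expR -ler_pdivrMr ?ltr0n //; apply: lb_le_inf.
  by exists (ln (gamma 1) / 1); exists 0.
move=> _ [n _ <-]; rewrite ler_pdivlMr ?ltr0n // mulrAC ler_pdivrMr ?ltr0n //.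
rewrite mulr_natr -lnXn // mulr_natr -lnXn // ler_ln ?posrE ?exprn_gt0 //.
apply: le_trans (c_le _) _; rewrite -natrX ler_nat.
exact: growth_functionX.
Qed.

End GrowthRate.

(** Words of length [n] in [B] are words of length [d * n] in [A]. Growth of a subgroup generated by
    short words thus bounds that of [A] from below. *)
Lemma growth_rate_sub_ball (R : realType) (G : groupType) (A B : set G) d :
    finite_set A -> finite_set B -> (0 < d)%N -> B `<=` word_ball A d ->
  (growth_rate R B <= growth_rate R A ^+ d)%R.
Proof.
move=> finA finB d_gt0 BA; apply: growth_rate_ge => // [|n].
  exact: growth_rate_gt0.
apply: le_trans (growth_rate_expn_le _ finB n) _; rewrite ler_nat.
apply: (leq_growth_function (f := id)) => // x.
exact: word_ball_comp.
Qed.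

(** * Homomorphisms, and growth of images *)

Section Morphism.
Local Open Scope group_scope.
Variables (G H : groupType) (f : G -> H).
Hypothesis fM : {morph f : x y / x * y}.

Lemma morph_group1 : f 1 = 1.
Proof. by apply: (@mulgI _ (f 1)); rewrite -fM !mulg1. Qed.

Lemma morph_groupV : {morph f : x / x^-1}.
Proof. by move=> x; apply: (@mulgI _ (f x)); rewrite -fM !mulgV morph_group1. Qed.

Lemma generated_image (A : set G) : generated (f @` A) = f @` generated A.
Proof.
have [A1 AM AV] := generated_subgroup A.
have [B1 BM BV] := generated_subgroup (f @` A).
apply/seteqP; split.
  apply: generated_sub => [|_ [x Ax <-]]; last by exists x => //; exact: sub_generated.
  split=> [|_ _ [x Ax <-] [y Ay <-]|_ [x Ax <-]].
  - by exists 1; [|exact: morph_group1].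
  - by exists (x * y); [exact: AM|exact: fM].
  - by exists x^-1; [exact: AV|exact: morph_groupV].
move=> _ [x Ax <-]; pose P := [set x | generated (f @` A) (f x)].
have Pg : is_subgroup P.
  split=> [|y z Py Pz|y Py]; rewrite /P /= ?morph_group1 ?fM ?morph_groupV //.
    exact: BM.
  exact: BV.
by apply: (generated_sub Pg _ Ax) => y Ay; apply: sub_generated; exists y.
Qed.

End Morphism.

Lemma growth_rate_image (R : realType) (G H : groupType) (f : G -> H) (A : set G) :
    {morph f : x y / (x * y)%g} -> finite_set A -> injective f ->
  (growth_rate R A <= growth_rate R (f @` A))%R.
Proof.
move=> fM finA f_inj; have finfA := finite_image f finA.
rewrite -[leRHS]expr1; apply: growth_rate_ge => // [|n].
  exact: growth_rate_gt0.
apply: le_trans (growth_rate_expn_le _ finA n) _; rewrite ler_nat mul1n.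
apply: leq_growth_function f_inj _ => // _ [w [wn Aw ->]].
exists (map f w); rewrite size_map big_map; split=> //.
  move=> _ /mapP[y /Aw Ay ->]; rewrite -(morph_groupV fM).
  by case: Ay => Ay; [left|right]; apply: imageP.
exact: (big_morph f fM (morph_group1 fM)).
Qed.

(** The powers [c ^+ n] are bounded by a polynomial in [n], which is impossible for [c > 1]. *)
Lemma abelian_growth_rate (R : realType) (G : groupType) (A : set G) : finite_set A ->
    (forall x y, A x -> A y -> commute x y) ->
  (growth_rate R A <= 1)%R.
Proof.
move=> finA cA; set c := growth_rate R A.
have c_gt0 : (0 < c)%R := growth_rate_gt0 _ finA.
rewrite leNgt; apply/negP => /ln_gt0 lnc.
pose r := #|` fset_set A|%fset.
have le_r n : (c ^+ n <= (n + n).+1%:R ^+ r)%R.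
  apply: le_trans (growth_rate_expn_le _ finA n) _; rewrite -natrX ler_nat.
  exact: abelian_growth_function.
(* Only the squares [n = m.+1 ^ 2] are used, so that [ln t <= t - 1] suffices. *)
have le_m m : (ln c * m.+1%:R <= (4 * r)%:R)%R.
  (* For [n = m.+1 ^ 2] one has [2 n + 1 <= (2 m + 3) ^ 2]; as [ln (2 m + 3) <= 2 (m + 1)], taking
     logarithms and dividing by [m + 1] leaves [4 r]. *)
  have le2 : (c ^+ (m.+1 ^ 2) <= (m + m).+3%:R ^+ (2 * r))%R.
    apply: le_trans (le_r _) _; rewrite -!natrX ler_nat expnM.
    by case: (r) => // r'; rewrite leq_exp2r //; nia.
  move: le2; rewrite -ler_ln ?posrE ?exprn_gt0 ?ltr0n // !lnXn ?ltr0n //.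
  have ln_m : (ln (m + m).+3%:R <= m.+1%:R * 2 :> R)%R.
    have -> : ((m + m).+3%:R = 1 + m.+1%:R * 2 :> R)%R.
      by rewrite -natrM nat1r; congr _%:R%R; lia.
    by apply: le_ln1Dx; apply: (@lt_le_trans _ _ 0%R); rewrite ?ltrN10 // mulr_ge0.
  rewrite -[leLHS]mulr_natr -[leRHS]mulr_natr natrX expr2 mulrA => le2.
  rewrite -(ler_pM2r (ltr0Sn R m)); apply: le_trans le2 _.
  have -> : ((4 * r)%:R * m.+1%:R = m.+1%:R * 2 * (2 * r)%:R :> R)%R.
    by rewrite !natrM; ring.
  by rewrite ler_wpM2r.
have r_ge0 : (0 <= (4 * r)%:R / ln c)%R by rewrite divr_ge0 // ltW.
have := archi_boundP r_ge0; move: (Num.bound _) => b.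
rewrite ltr_pdivrMr // mulrC => lt_b.
have := le_m b; rewrite leNgt => /negP; apply; apply: lt_le_trans lt_b _.
by rewrite ler_wpM2l ?ler_nat // ltW.
Qed.

(** * Finitely generated subgroups of K-by-Z groups *)

Section TwoGenerators.
Local Open Scope group_scope.
Variables (R : realType) (G : groupType) (A : set G).
Hypotheses (G_tf : torsion_free G) (finA : finite_set A).

(** The words of length [n] give [2 ^ n] distinct elements of the ball of radius [d * n]. *)
Lemma free_semigroup_growth_rate x y d : (0 < d)%N ->
    word_ball A d x -> word_ball A d y ->
    (forall s t : seq bool, size s = size t ->
       \prod_(b <- s) (if b then x else y) = \prod_(b <- t) (if b then x else y) ->
       s = t) ->
  (2 <= growth_rate R A ^+ d)%R.
Proof.
move=> d_gt0 Ax Ay free; apply: growth_rate_ge => // n.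
rewrite -natrX ler_nat.
pose f (t : n.-tuple bool) := \prod_(b <- t) (if b then x else y).
have f_inj : injective f.
  by move=> s t st; apply: val_inj; apply: free => //; rewrite !size_tuple.
have -> : (2 ^ n)%N = size (map f (enum {: n.-tuple bool})).
  by rewrite size_map -cardE card_tuple card_bool.
apply: size_le_growth_function => //; first by rewrite map_inj_uniq ?enum_uniq.
move=> _ /mapP[t _ ->]; apply: (@word_ball_comp _ _ [set x; y]).
  by move=> _ [->|->].
exists [seq if b then x else y | b : bool <- t].
rewrite size_map size_tuple big_map; split=> // _ /mapP[b _ ->].
by left; case: b; [left|right].
Qed.

(** Dividing [i] and [j] by their gcd gives coprime [p] and [q] with [h ^ q = (h ^ a) ^ p]; both are
    units only if [h ^ a] is [h] or [h^-1]. The exponent 5 counts the letters of [h * a^-1]. *)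
Lemma unequal_powers_growth_rate c h a (i j : int) :
    word_ball A 4 h -> A a -> h = zexpg c i -> h ^ a = zexpg c j ->
    h ^ a <> h -> h ^ a <> h^-1 ->
  (2 <= growth_rate R A ^+ 5)%R.
Proof.
move=> Ah Aa hi hj ha haV.
have h1 : h <> 1 by move=> h1; apply: ha; rewrite h1 conj1g.
have i0 : i != 0%R by apply/eqP => i0; apply: h1; rewrite hi i0.
have g0 : gcdz i j != 0%R by rewrite gcdz_eq0 negb_and i0.
have := Bezoutz i j; have := dvdz_gcdr i j; have := dvdz_gcdl i j.
move: (gcdz i j) g0 => g g0 /dvdzP[p ip] /dvdzP[q jq] [v [w vw]].
have co_pq : coprimez p q.
  apply/coprimezP; exists (v, w) => /=; apply: (mulIf g0).
  by rewrite mul1r -[RHS]vw ip jq; ring.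
have pq : zexpg h q = zexpg (h ^ a) p.
  by rewrite hj hi -!zexpgM ip jq; congr (zexpg _ _); ring.
have pq_nonunit : ~ (`|p|%N = 1%N /\ `|q|%N = 1%N).
  move=> [p1 q1]; have [pq1|pq1] : q = p \/ q = (- p)%R by lia.
    by apply: ha; rewrite hj hi jq ip pq1.
  by apply: haV; rewrite hj hi jq ip pq1 mulNr zexpgN.
have Aa1 := word_ballV (word_ball_letter Aa).
apply: (free_semigroup_growth_rate (x := h * a^-1) (y := a^-1)) => // [||s t st].
- exact: (@word_ballM _ _ 4 1).
- by rewrite -[a^-1]mulg1; apply: (@word_ballM _ _ 1 4); last exact: word_ball1.
have wordE (r : seq bool) : \prod_(b <- r) (if b then h * a^-1 else a^-1) =
    twisted_word h a r * a ^- size r.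
  by rewrite -twisted_wordE; apply: eq_bigr => -[] _; rewrite /= ?mul1g.
rewrite !wordE st => /mulIg.
by apply: (twisted_word_inj G_tf h1 co_pq pq pq_nonunit).
Qed.

End TwoGenerators.

(** * Homomorphisms to the integers *)

Section IntegerCharacter.
Local Open Scope group_scope.
Variables (G : groupType) (pi : G -> int).
Hypothesis piM : forall x y, pi (x * y) = (pi x + pi y)%R.

Lemma character1 : pi 1 = 0%R.
Proof. by apply: (addrI (pi 1)); rewrite -piM mulg1 addr0. Qed.

Lemma characterV x : pi x^-1 = (- pi x)%R.
Proof. by apply: (addrI (pi x)); rewrite -piM mulgV character1 subrr. Qed.

Lemma characterX x i : pi (zexpg x i) = (pi x * i)%R.
Proof.
have piXn n : pi (x ^+ n) = (pi x * n%:Z)%R.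
  elim: n => [|n IHn]; first by rewrite mulr0 character1.
  by rewrite expgS piM IHn intS mulrDr mulr1.
by case: i => n; rewrite ?NegzE ?mulrN -piXn // characterV.
Qed.

End IntegerCharacter.

(** * Growth dichotomy for a torsion-free group with a homomorphism to the integers *)

Section Dichotomy.
Local Open Scope group_scope.
Variables (R : realType) (G : groupType) (pi : G -> int) (u : R).
Hypotheses (G_tf : torsion_free G) (piM : forall x y, pi (x * y) = (pi x + pi y)%R)
  (u_gt1 : (1 < u)%R).
Hypothesis ker_growth : forall B : set G, finite_set B -> (forall b, B b -> pi b = 0%R) ->
  (u <= growth_rate R B)%R \/ is_cyclic (generated B).

Let pi1 := character1 piM.
Let piV := characterV piM.
Let piX := characterX piM.

Let piJ x y : pi (x ^ y) = pi x.
Proof. by rewrite !piM piV addrC addrK. Qed.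

Let piR x y : pi [~ x, y] = 0%R.
Proof. by rewrite piM piJ piV addNr. Qed.

Let ker_subgroup : is_subgroup [set x | pi x = 0%R].
Proof.
split=> //= [x y px py|x px]; first by rewrite piM px py.
by rewrite piV px oppr0.
Qed.

(** The growth rate of an abelian group is at most 1, hence less than [u]. *)
Lemma ker_abelian_cyclic (B : set G) : finite_set B -> (forall b, B b -> pi b = 0%R) ->
  (forall x y, B x -> B y -> commute x y) -> is_cyclic (generated B).
Proof.
move=> finB piB cB; have [uB|//] := ker_growth finB piB.
have := lt_le_trans u_gt1 (le_trans uB (abelian_growth_rate R finB cB)).
by rewrite ltxx.
Qed.

(** The pair generates a cyclic group; if [x = c ^ i] and [y = c ^ j], then [x ^ j = y ^ i], and [j]
    is nonzero because [y] is nontrivial. *)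
Lemma ker_commensurable x y : pi x = 0%R -> pi y = 0%R -> y <> 1 -> commute x y ->
  exists i j, i <> 0%R /\ zexpg x i = zexpg y j.
Proof.
move=> px py y1 cxy; have [||c] := ker_abelian_cyclic (finite_set2 x y).
- by move=> _ [->|->].
- by move=> _ _ [->|->] [->|->] //; apply: commute_sym.
rewrite generated1 => xyE.
have [i _ ci] : range (zexpg c) x by rewrite -xyE; apply: sub_generated; left.
have [j _ cj] : range (zexpg c) y by rewrite -xyE; apply: sub_generated; right.
exists j, i; split; last by rewrite -ci -cj -!zexpgM mulrC.
by move=> j0; apply: y1; rewrite -cj j0.
Qed.

Variable A : set G.
Hypothesis finA : finite_set A.

Let comms : set G := [set [~ p.1, p.2] | p in A `*` A].
(** Conjugates are included so that, once this set generates a cyclic group, [h] and [h ^ a] are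
    powers of one element. *)
Let conj_comms : set G := comms `|` [set p.1 ^ p.2 | p in comms `*` A].

Let fin_comms : finite_set comms.
Proof. exact/finite_image/finite_setX. Qed.

Let fin_conj_comms : finite_set conj_comms.
Proof. by rewrite finite_setU; split=> //; apply/finite_image/finite_setX. Qed.

Lemma comms_ball h : comms h -> word_ball A 4 h.
Proof. by move=> [[x y] [Ax Ay] <-]; apply: word_ballR. Qed.

(** Conjugation adds two letters to the four of a commutator; the exponent [1 / 6] of [u] comes from
    here. *)
Lemma conj_comms_ball : conj_comms `<=` word_ball A 6.
Proof.
move=> x [Ah|[[h a] [Ah Aa] <-]].
  rewrite -[x]mulg1; apply: (@word_ballM _ _ 4 2).
    exact: comms_ball.
  exact: word_ball1.
by apply: word_ballJ => //; apply: comms_ball.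
Qed.

Let S := generated A.
Let Sg : is_subgroup S := generated_subgroup A.

(** * The case where every generator fixes or inverts the commutators *)

Section InvertedCommutators.
Variable c : G.
Hypotheses (cE : generated conj_comms = generated [set c])
  (hJ : forall h a, comms h -> A a -> h ^ a = h \/ h ^ a = h^-1).

Let M := generated comms.

Let M_sub_cycle x : M x -> exists i, x = zexpg c i.
Proof.
move=> Mx; suff [i _ <-] : range (zexpg c) x by exists i.
rewrite -generated1 -cE; apply: (generated_sub (generated_subgroup _) _ Mx).
by move=> y cy; apply: sub_generated; left.
Qed.

Let M_commute x y : M x -> M y -> commute x y.
Proof.
move=> /M_sub_cycle[i ->] /M_sub_cycle[j ->].
by rewrite /commute -!zexpgD addrC.
Qed.

Let commsJ h g : comms h -> S g -> h ^ g = h \/ h ^ g = h^-1.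
Proof.
move=> ch; pose P := [set g | h ^ g = h \/ h ^ g = h^-1].
suff Pg : is_subgroup P by apply: (generated_sub Pg) => a; exact: hJ.
split=> [|x y Px Py|x Px]; first by left; rewrite conjg1.
  by rewrite /P /= conjgM; case: Px => ->; case: Py => Py;
    rewrite ?conjVg Py ?invgK; auto.
case: Px => hx; first by left; rewrite -{1}hx conjgK.
by right; apply: (conjg_inj x); rewrite conjgKV conjVg hx invgK.
Qed.

Let M_normal x g : M x -> S g -> M (x ^ g).
Proof.
move=> Mx Sg'; have [M1 MM MV] := generated_subgroup comms.
have Mg := conjg_preimage_subgroup g (generated_subgroup comms).
apply: (generated_sub Mg _ Mx) => h ch /=.
by have [->|->] := commsJ ch Sg'; [|apply: MV]; apply: sub_generated.
Qed.

(** As [M] is normal in [S], the identities for [[~ v * w, z]] and [[~ v^-1, z]] make [P y] a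
    subgroup. The first argument is extended from [A] to [S] with the second in [A]; inverting
    commutators then exchanges the roles. *)
Let commutator_M x y : S x -> S y -> M [~ x, y].
Proof.
have [S1 SM SV] := Sg; have [M1 MM MV] := generated_subgroup comms.
pose P y := [set x | S x /\ M [~ x, y]].
have Pg z : S z -> is_subgroup (P z).
  move=> Sz; split=> [|v w [Sv Mv] [Sw Mw]|v [Sv Mv]].
  - by split=> //; rewrite comm1g.
  - split; first exact: SM.
    have -> : [~ v * w, z] = [~ v, z] ^ w * [~ w, z].
      by rewrite !commgEl !conjgE !invgM !mulgA !(mulgK, mulgVK).
    by apply: MM => //; apply: M_normal.
  - split; first exact: SV.
    have -> : [~ v^-1, z] = ([~ v, z] ^ v^-1)^-1.
      by rewrite !commgEl !conjgE !invgM !invgK !mulgA !(mulgK, mulgVK).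
    by apply: MV; apply: M_normal => //; exact: SV.
have SA z : A z -> S z by apply: sub_generated.
have PA z w : A z -> S w -> M [~ w, z].
  move=> Az Sw; suff [] : P z w by [].
  apply: (generated_sub (Pg z (SA z Az)) _ Sw) => v Av; split; first exact: SA.
  by apply: sub_generated; exists (v, z).
move=> Sx Sy; suff [] : P y x by [].
apply: (generated_sub (Pg y Sy) _ Sx) => z Az; split; first exact: SA.
by rewrite -invgR; apply: MV; exact: PA.
Qed.

Let H := [set x | S x /\ pi x = 0%R].

(** If some commutator [k] of generators is nontrivial, each element of [H] has a nonzero power that
    is a power of [k]. Relations are checked on such powers and lifted by uniqueness of roots. *)
Lemma kernel_abelian_or_inverted :
  (forall x y, H x -> H y -> commute x y) /\
  (forall g, S g -> (forall x, H x -> x ^ g = x) \/ (forall x, H x -> x ^ g = x^-1)).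
Proof.
have [S1 SM SV] := Sg.
(* Without a nontrivial commutator of generators, [M] is trivial and [S] is abelian. *)
have [[k [ck k1]]|comms1] := pselect (exists k, comms k /\ k <> 1); last first.
  have M1 x : M x -> x = 1.
    move=> Mx; have T1 : is_subgroup [set (1 : G)].
      by split=> // [_ _ -> ->|_ ->]; rewrite ?mulg1 ?invg1.
    apply: (generated_sub T1 _ Mx) => h ch /=.
    by apply: contrapT => h1; apply: comms1; exists h.
  split=> [x y [Sx _] [Sy _]|g Sgg].
    by apply/commgP; apply/eqP; apply: M1; exact: commutator_M.
  by left=> x [Sx _]; apply/conjg_fixP; apply/eqP; apply: M1; exact: commutator_M.
have Mk : M k by apply: sub_generated.
have Hk : H k.
  case: ck => -[v w] [Av Aw] <-; split; last exact: piR.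
  have [Sv Sw] : S v /\ S w by split; exact: sub_generated.
  exact: (SM _ _ (SV _ Sv) (subgroupJ Sg Sv Sw)).
have Hg : is_subgroup H.
  have [p1 pM pV] := ker_subgroup.
  by split=> [|x y [Sx px] [Sy py]|x [Sx px]]; split=> //; do ?[exact: S1|exact: p1|
    exact: SM|exact: SV|exact: pM|exact: pV].
have [H1 HM HV] := Hg.
have HJ x g : H x -> S g -> H (x ^ g).
  by move=> [Sx px] Sgg; split; [exact: (subgroupJ Sg Sx Sgg)|rewrite /= piJ].
have k_inv : k <> k^-1.
  move=> kV; have k2 : k ^+ 2 = 1 by rewrite expg2 {2}kV mulgV.
  exact/k1/(@G_tf k 2).
(* If [x] inverted [k], then [x * x] would commute with [k], so [(x * x) ^ i = k ^ j] with [i]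
   nonzero. As [x] fixes this element, [k ^ j = k ^ (- j)], whence [j = 0] and [x = 1], which does
   not invert [k]. *)
have k_central x : H x -> k ^ x = k.
  move=> Hx; have [//|kx] := commsJ ck Hx.1; exfalso.
  have cxk : commute (x * x) k.
    apply/commute_sym/commgP; rewrite -conjg_fix conjgM kx conjVg kx invgK eqxx //.
  have [i [j [i0 xk]]] := ker_commensurable (HM _ _ Hx Hx).2 Hk.2 k1 cxk.
  have : zexpg k j ^ x = zexpg k j.
    by rewrite -xk; apply/conjg_fixP/commgP/commute_sym/commute_zexpg/commuteM.
  rewrite zexpgJ kx zexpVg -zexpgN => /(zexpg_inj G_tf k1) jj.
  have j0 : j = 0%R by lia.
  move: xk; rewrite j0 => /(zexpg_eq1 G_tf)[//|xx].
  have x1 : x = 1 by apply: (@G_tf x 2).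
  by apply: k_inv; rewrite -kx x1 conjg1.
have k_comm x : H x -> commute x k.
  by move=> /k_central/conjg_fixP/commgP/commute_sym.
have Hcomm x : H x -> exists i j, i <> 0%R /\ zexpg x i = zexpg k j.
  by move=> Hx; apply: ker_commensurable (k_comm x Hx); [exact: Hx.2|exact: Hk.2|].
(* The element [m ^ f = k ^ e] is fixed by [x], and [m ^ x] commutes with [m] inside [M]. *)
have M_central x m : H x -> M m -> m ^ x = m.
  move=> Hx Mm; have [e mc] := M_sub_cycle Mm; have [f kc] := M_sub_cycle Mk.
  have f0 : f <> 0%R by move=> f0; apply: k1; rewrite kc f0.
  apply: (zexpIg G_tf f0); first by apply: M_commute => //; apply: M_normal Hx.1.
  have mk : zexpg m f = zexpg k e by rewrite mc kc -!zexpgM mulrC.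
  by rewrite -zexpgJ mk zexpgJ k_central.
(* [x ^ y] and [x] have the same [i]-th power; they commute because [x ^ y = x * [~ x, y]] and [H]
   centralizes [M]. *)
have H_abelian x y : H x -> H y -> commute x y.
  move=> Hx Hy; have [i [j [i0 xk]]] := Hcomm x Hx.
  suff xy : x ^ y = x by apply/commgP; rewrite -conjg_fix xy.
  apply: (zexpIg G_tf i0); last by rewrite -zexpgJ xk zexpgJ k_central.
  have -> : x ^ y = x * [~ x, y] by rewrite commgEl mulVKg.
  apply/commute_sym/commuteM => //; apply/commgP; rewrite -commg1_sym -conjg_fix.
  by rewrite M_central //; apply: commutator_M; [exact: Hx.1|exact: Hy.1].
(* The action of [g] on [k] decides its action on [H], roots being unique in the abelian group
   [H]. *)
split=> // g Sgg; have [kg|kg] := commsJ ck Sgg; [left|right] => x Hx.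
  have [i [j [i0 xk]]] := Hcomm x Hx.
  apply: (zexpIg G_tf i0); first exact: (H_abelian _ _ (HJ x g Hx Sgg) Hx).
  by rewrite -zexpgJ xk zexpgJ kg.
have [i [j [i0 xk]]] := Hcomm x Hx.
apply: (zexpIg G_tf i0); first exact: (H_abelian _ _ (HJ x g Hx Sgg) (HV x Hx)).
by rewrite -zexpgJ xk zexpgJ kg !zexpVg xk.
Qed.

End InvertedCommutators.

(** [s] realizes the least nonzero absolute value of [pi] on [S]; a nonzero remainder would be
    smaller. If [pi] vanishes on [S], both sides are zero for [s = 1]. *)
Lemma subgroup_pi_generator : exists2 s, S s &
  (s = 1 \/ pi s <> 0%R) /\ forall g, S g -> pi g = (pi s * (pi g %/ pi s)%Z)%R.
Proof.
have [S1 SM SV] := Sg.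
have [[g0 [Sg0 pg0]]|S0] := pselect (exists g, S g /\ pi g <> 0%R); last first.
  exists 1 => //; split=> [|g Sgg]; first by left.
  by rewrite pi1 mul0r; apply: contrapT => pg; apply: S0; exists g.
pose P n := `[< exists g, [/\ S g, pi g <> 0%R & `|pi g|%N = n] >].
have exP : exists n, P n by exists `|pi g0|%N; apply/asboolP; exists g0.
have [n /asboolP[s [Ss ps sn]] n_min] := ex_minnP exP.
exists s => //; split=> [|g Sgg]; first by right.
suff gmod : (pi g %% pi s)%Z = 0%R by rewrite {1}(divz_eq (pi g) (pi s)) gmod addr0 mulrC.
apply: contrapT => pgs; have ps0 : pi s != 0%R by apply/eqP.
have : P `|(pi g %% pi s)%Z|%N.
  apply/asboolP; exists (g * zexpg s (- (pi g %/ pi s)%Z)%R).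
  have -> : pi (g * zexpg s (- (pi g %/ pi s)%Z)%R) = (pi g %% pi s)%Z.
    by rewrite piM piX {1}(divz_eq (pi g) (pi s)); ring.
  split=> //; exact: (SM _ _ Sgg (subgroup_zexpg _ Sg Ss)).
move=> /n_min; rewrite -sn => le_mod.
have := ltz_mod (pi g) ps0; have := modz_ge0 (pi g) ps0; lia.
Qed.

Lemma growth_or_metacyclic :
  (Num.min (u `^ (1 / 6)) (2 `^ (1 / 16)) <= growth_rate R A)%R \/
  exists x s, [/\ S = [set zexpg x ij.1 * zexpg s ij.2 | ij in [set: int * int]],
    pi x = 0%R, s = 1 \/ pi s <> 0%R & x ^ s = x \/ x ^ s = x^-1].
Proof.
have rA_gt0 := growth_rate_gt0 R finA.
have [|] := leP (Num.min (u `^ (1 / 6)) (2 `^ (1 / 16)))%R (growth_rate R A).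
  by left.
rewrite lt_min => /andP[ru r2]; right.
(* Weakens the exponent from [1 / e] to [1 / d] for [d <= e], as [v >= 1]. It serves with
   [d = e = 6] for [u], and with [d = 5], [e = 16] for 2. *)
have powR_lt (v : R) (d e : nat) : (1 <= v)%R -> (0 < d <= e)%N ->
    (growth_rate R A < v `^ (1 / e%:R))%R -> (growth_rate R A ^+ d < v)%R.
  move=> v1 /andP[d_gt0 de] rv; have e_gt0 := leq_trans d_gt0 de.
  have : (growth_rate R A ^+ d < (v `^ (1 / e%:R)) ^+ d)%R.
    by rewrite ltr_pXn2r // nnegrE ?powR_ge0 ?ltW.
  move=> /lt_le_trans; apply; rewrite -powR_mulrn ?powR_ge0 // -powRrM.
  rewrite -[leRHS]powRr1 ?(le_trans ler01) // ler_powR //.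
  by rewrite mulrAC mul1r ler_pdivrMr ?ltr0n // mul1r ler_nat.
have [b [Bb|[[h a] [Bh _] <-]]|uB|[c cE]] := ker_growth fin_conj_comms.
- by case: Bb => -[x y] _ <-; exact: piR.
- by rewrite piJ; case: Bh => -[x y] _ <-; exact: piR.
- have := powR_lt u 6 6 (ltW u_gt1) isT ru.
  rewrite ltNge (le_trans uB) //.
  exact: growth_rate_sub_ball conj_comms_ball.
have hJ h a : comms h -> A a -> h ^ a = h \/ h ^ a = h^-1.
  move=> ch Aa; apply: contrapT => /not_orP[ha haV].
  have in_cyc z : conj_comms z -> exists i, z = zexpg c i.
    move=> Bz; have [i _ <-] : range (zexpg c) z.
      by rewrite -generated1 -cE; exact: sub_generated.
    by exists i.
  have [i hi] : exists i, h = zexpg c i by apply: in_cyc; left.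
  have [j hj] : exists j, h ^ a = zexpg c j.
    by apply: in_cyc; right; exists (h, a).
  have r5 := unequal_powers_growth_rate R G_tf finA (comms_ball ch) Aa hi hj ha haV.
  by have := powR_lt 2%R 5 16 _ isT r2; rewrite ler1n ltNge r5 => /(_ isT).
have [H_ab H_J] := kernel_abelian_or_inverted cE hJ.
have [s Ss [s_pi pi_s]] := subgroup_pi_generator.
have [S1 SM SV] := Sg.
(* [f] strips off the power of [s] that carries the value of [pi]. *)
pose f g := g * zexpg s (- (pi g %/ pi s)%Z)%R.
have Hf g : S g -> S (f g) /\ pi (f g) = 0%R.
  move=> Sgg; split; first exact: (SM _ _ Sgg (subgroup_zexpg _ Sg Ss)).
  by rewrite piM piX {1}(pi_s g Sgg) mulrN subrr.
have SA a : A a -> S a by apply: sub_generated.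
(* The image of [A] under [f] is a finite set of commuting kernel elements, so it generates a cyclic
   group, with generator [x]. *)
have [_ [a /SA/Hf[_ pa] <-] //||x xE] := @ker_abelian_cyclic (f @` A) (finite_image f finA).
  by move=> _ _ [a /SA/Hf fa <-] [b /SA/Hf fb <-]; exact: H_ab.
have Sx_pi : S x /\ pi x = 0%R.
  have SHg : is_subgroup [set y | S y /\ pi y = 0%R].
    have [p1 pM pV] := ker_subgroup.
    by split=> [|y z [Sy py] [Sz pz]|y [Sy py]]; split; first
      [exact: S1|exact: p1|exact: SM|exact: SV|exact: pM|exact: pV].
  have xB : generated [set f x | x in A] x by rewrite xE; exact: sub_generated.
  by apply: (generated_sub SHg _ xB) => _ [a /SA/Hf fa <-].
have [Sx px] := Sx_pi.
(* Powers of [x] move to the left past elements of [S], so the products [x ^ i * s ^ j] are closed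
   under multiplication and inversion. *)
have xJ y i : S y -> exists k, y * zexpg x i = zexpg x k * y.
  move=> Sy; have [/(_ x Sx_pi) xy|/(_ x Sx_pi) xy] := H_J _ (SV _ Sy).
    by exists i; rewrite conjgCV zexpgJ xy.
  by exists (- i)%R; rewrite conjgCV zexpgJ xy zexpVg zexpgN.
have SX y i : S y -> S (zexpg y i) by apply: subgroup_zexpg.
exists x, s; split=> //; last first.
  by have [/(_ x Sx_pi) xs|/(_ x Sx_pi) xs] := H_J _ Ss; [left|right].
apply/seteqP; split; last first.
  by move=> _ [[i j] _ <-]; exact: (SM _ _ (SX _ _ Sx) (SX _ _ Ss)).
apply: generated_sub => [|a Aa].
  split=> [|_ _ [[i j] _ <-] [[k l] _ <-]|_ [[i j] _ <-]] /=.
  - by exists (0%R, 0%R) => //; rewrite mulg1.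
  - have [m xm] := xJ (zexpg s j) k (SX _ _ Ss).
    exists (i + m, j + l)%R => //=.
    by rewrite !zexpgD !mulgA; congr (_ * _); rewrite -!mulgA xm.
  - have [m xm] := xJ (zexpg s (- j)%R) (- i)%R (SX _ _ Ss).
    by exists (m, - j)%R => //=; rewrite -xm invgM !zexpgN.
have [i _ xi] : range (zexpg x) (f a).
  by rewrite -generated1 -xE; apply: sub_generated; exists a.
by exists (i, pi a %/ pi s)%Z => //=; rewrite xi /f zexpgN mulgVK.
Qed.

End Dichotomy.

(** * Classification of the groups of products [x ^ i * s ^ j] *)

Section Metacyclic.
Local Open Scope group_scope.
Variables (G : groupType) (G_tf : torsion_free G) (pi : G -> int).
Hypothesis piM : forall x y, pi (x * y) = (pi x + pi y)%R.
Implicit Types x s : G.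

Lemma isomorphic_infinite_cyclic x : x <> 1 ->
  isomorphic_to (range (zexpg x)) infinite_cyclic.
Proof.
move=> x1; pose f : {multiplicative infinite_cyclic -> G} :=
  HB.pack (zexpg x : infinite_cyclic -> G)
    (isMultiplicative.Build infinite_cyclic G (zexpg x) (zexpgD x)).
by exists f; split=> //; exact: zexpg_inj.
Qed.

(** Applying [pi] recovers the exponent of [s], then torsion-freeness that of [x]. *)
Lemma zexpg_pair_inj x s : x <> 1 -> pi x = 0%R -> pi s <> 0%R ->
  injective (fun ij : int * int => zexpg x ij.1 * zexpg s ij.2).
Proof.
move=> x1 px ps [i j] [k l] /= ijkl.
have jl : j = l.
  move: (congr1 pi ijkl); rewrite !piM !(characterX piM) px !mul0r !add0r.
  by apply: mulfI; apply/eqP.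
by move: ijkl; rewrite jl => /mulIg/(zexpg_inj G_tf x1) ->.
Qed.

Lemma isomorphic_cyclic_square x s : x <> 1 -> pi x = 0%R -> pi s <> 0%R ->
    x ^ s = x ->
  isomorphic_to [set zexpg x ij.1 * zexpg s ij.2 | ij in [set: int * int]]
    (infinite_cyclic * infinite_cyclic)%type.
Proof.
move=> x1 px ps xs; have cxs : commute x s by apply/commgP; rewrite -conjg_fix xs.
pose F (ij : infinite_cyclic * infinite_cyclic) := zexpg x ij.1 * zexpg s ij.2.
have FM : {morph F : p q / p * q}.
  move=> [i j] [k l]; rewrite /F /= !zexpgD -!mulgA; congr (_ * _).
  rewrite !mulgA; congr (_ * _); apply/commute_zexpg/commute_sym.
  exact: commute_zexpg.
pose f : {multiplicative (infinite_cyclic * infinite_cyclic)%type -> G} :=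
  HB.pack F (isMultiplicative.Build _ _ F FM).
by exists f; split=> //; exact: zexpg_pair_inj.
Qed.

Lemma isomorphic_klein x s : x <> 1 -> pi x = 0%R -> pi s <> 0%R ->
    x ^ s = x^-1 ->
  isomorphic_to [set zexpg x ij.1 * zexpg s ij.2 | ij in [set: int * int]]
    klein_bottle_group.
Proof.
move=> x1 px ps xs.
(* The presentation conjugates by [s^-1], the hypothesis by [s]; inversion being an involution, the
   one relation gives the other. *)
have sx : s * x * s^-1 = x^-1.
  have -> : s * x * s^-1 = x ^ s^-1 by rewrite conjgE invgK mulgA.
  by apply: (@conjg_inj _ s); rewrite conjgKV conjVg xs invgK.
have [f [fa ft] _] := klein_presentation sx.
have fE p : f p = zexpg x p.1 * zexpg s p.2.
  case: p => i j /=; have -> : (i, j) = sd_base inversionZ i * ((1, j) : klein_bottle_group).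
    by congr pair; rewrite /= ?mulg1 ?add0r.
  rewrite gmulfM; congr (_ * _).
    apply: (eq_zexpg (f := fun i => f (sd_base inversionZ i))) => // m n.
    by rewrite -gmulfM.
  apply: (eq_zexpg (f := fun j => f ((1, j) : klein_bottle_group))) => // m n.
  by rewrite -gmulfM; congr (f _); congr pair; rewrite /= autz1 mulg1.
exists f; split=> [p q|]; first by rewrite !fE => /(zexpg_pair_inj x1 px ps).
by apply/seteqP; split=> [_ [p _ <-]|_ [p _ <-]]; exists p.
Qed.

(** If [x] or [s] is trivial, at most one cyclic factor survives. Otherwise the exponents are
    unique, and the action of [s] on [x] decides between the last two cases. *)
Lemma metacyclic_classification (S : set G) x s :
    S = [set zexpg x ij.1 * zexpg s ij.2 | ij in [set: int * int]] ->
    pi x = 0%R -> s = 1 \/ pi s <> 0%R -> x ^ s = x \/ x ^ s = x^-1 ->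
  [\/ S = [set 1],
      isomorphic_to S infinite_cyclic,
      isomorphic_to S (infinite_cyclic * infinite_cyclic)%type
    | isomorphic_to S klein_bottle_group].
Proof.
move=> -> px s_or xs.
have [->|x1] := pselect (x = 1).
  have -> : [set zexpg 1 ij.1 * zexpg s ij.2 | ij in [set: int * int]] = range (zexpg s).
    apply/seteqP; split=> [_ [[i j] _ <-]|_ [j _ <-]].
      by exists j; rewrite /= ?zexp1g ?mul1g.
    by exists (0%R, j); rewrite //= mul1g.
  have [->|s1] := pselect (s = 1); last by apply: Or42; exact: isomorphic_infinite_cyclic.
  apply: Or41; apply/seteqP; split=> [_ [j _ <-]|_ ->]; first exact: zexp1g.
  by exists 0%R.
case: s_or => [s1|ps].
  apply: Or42; rewrite s1.
  have -> : [set zexpg x ij.1 * zexpg 1 ij.2 | ij in [set: int * int]] = range (zexpg x).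
    apply/seteqP; split=> [_ [[i j] _ <-]|_ [j _ <-]].
      by exists i; rewrite /= ?zexp1g ?mulg1.
    by exists (j, 0%R); rewrite //= mulg1.
  exact: isomorphic_infinite_cyclic.
case: xs => xs; first by apply: Or43; exact: isomorphic_cyclic_square.
by apply: Or44; exact: isomorphic_klein.
Qed.

End Metacyclic.

(** * Bounds on the growth constant *)

Lemma growth_constant_le (R : realType) (G : groupType) (A : set G) : finite_set A ->
  (growth_constant R (generated A) <= growth_rate R A)%R.
Proof.
move=> finA; apply: ge_inf; last by exists A.
by exists 0%R => _ [B [finB _] <-]; apply/ltW/growth_rate_gt0.
Qed.

(** Finite generation makes the infimum range over a nonempty set; on the empty set [inf] is a
    default value. *)
Lemma growth_constant_ge (R : realType) (G : groupType) (S : set G) (c : R) :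
    finitely_generated S ->
    (forall A, finite_generating_set S A -> c <= growth_rate R A)%R ->
  (c <= growth_constant R S)%R.
Proof.
move=> [A SA] cS; apply: lb_le_inf; first by exists (growth_rate R A), A.
by move=> _ [B SB <-]; exact: cS.
Qed.

(** * Transfer of the hypotheses from [K] to its extension *)

Section KernelGrowth.
Local Open Scope group_scope.
Variables (R : realType) (K : groupType) (u : R) (alpha : automorphism K).
Hypotheses (K_tf : torsion_free K)
  (K_growth : forall H : set K, is_subgroup H -> finitely_generated H ->
     (u <= growth_constant R H)%R \/ is_cyclic H).

(** The second coordinate of a torsion element vanishes, so the element lies in the copy of [K]. *)
Lemma semidirectZ_torsion_free : torsion_free (semidirectZ alpha).
Proof.
move=> p n n_gt0 pn1.
have p2n m : (p ^+ m).2 = (p.2 *+ m)%R.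
  by elim: m => // m IHm; rewrite expgS mulrS -IHm.
have p2 : p.2 = 0%R.
  have := congr1 snd pn1; rewrite p2n => /eqP; rewrite mulrn_eq0 gtn_eqF //=.
  by move/eqP.
have pE : p = sd_base alpha p.1 by case: p p2 {pn1 p2n} => k m /= ->.
have baseX m k : sd_base alpha k ^+ m = sd_base alpha (k ^+ m).
  by elim: m => // m IHm; rewrite !expgS IHm.
move: pn1; rewrite pE baseX => /(congr1 fst) /= /K_tf -> //.
Qed.

(** [B] is the image under [sd_base] of a finite subset of [K]; this embedding transports both lower
    bounds on growth and cyclicity. *)
Lemma semidirectZ_kernel_growth (B : set (semidirectZ alpha)) : finite_set B ->
    (forall b, B b -> b.2 = 0%R) ->
  (u <= growth_rate R B)%R \/ is_cyclic (generated B).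
Proof.
move=> finB B0; pose B' := fst @` B; have finB' : finite_set B' := finite_image _ finB.
have BE : B = sd_base alpha @` B'.
  apply/seteqP; split=> [p Bp|_ [_ [p Bp <-] <-]].
    by exists p.1; [exists p|move: (B0 p Bp); case: p {Bp} => k m /= ->].
  by have := B0 p Bp; case: p Bp => k m /= Bp m0; rewrite m0 in Bp.
have baseM := @sd_baseM K alpha.
have [|uB|[x xE]] := K_growth (generated_subgroup B'); first by exists B'.
  left; rewrite BE; apply: le_trans (growth_rate_image R baseM finB' _).
    exact: le_trans uB (growth_constant_le R finB').
  by move=> k l [].
right; exists (sd_base alpha x).
by rewrite BE generated_image // xE -generated_image // image_set1.
Qed.

End KernelGrowth.

Local Open Scope ring_scope.

Theorem corollary3p2 (R : realType) (K : groupType)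
    (K_fg : finitely_generated [set: K]) (K_tf : torsion_free K)
    (u : R) (u_gt1 : 1 < u)
    (K_growth : forall H : set K, is_subgroup H -> finitely_generated H ->
       u <= growth_constant R H \/ is_cyclic H)
    (alpha : automorphism K) (S : set (semidirectZ alpha))
    (S_subgroup : is_subgroup S) (S_fg : finitely_generated S) :
  (uniform_exponential_growth R S /\
     Num.min (u `^ (1 / 6)) (2 `^ (1 / 16)) <= growth_constant R S) \/
  [\/ S = [set 1%g],
      isomorphic_to S infinite_cyclic,
      isomorphic_to S (infinite_cyclic * infinite_cyclic)%type
    | isomorphic_to S klein_bottle_group].
Proof.
set m := Num.min _ _.
have piM (x y : semidirectZ alpha) : (x * y)%g.2 = x.2 + y.2 by [].
have G_tf := semidirectZ_torsion_free (alpha := alpha) K_tf.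
(* Either every finite generating set reaches the bound, and so does the infimum, or a single slow
   one determines the structure of [S]. *)
have [all_ge|] := pselect (forall A, finite_generating_set S A -> m <= growth_rate R A).
  left; have m_le := growth_constant_ge S_fg all_ge; split=> //.
  (* Uniform exponential growth follows because [m] itself exceeds 1. *)
  apply: lt_le_trans m_le; rewrite lt_min.
  have powR_gt1 (v : R) (d : nat) : 1 < v -> (0 < d)%N -> 1 < v `^ (1 / d%:R).
    move=> v1 d_gt0; have v0 := ltW (lt_trans ltr01 v1).
    have := @gt0_ltr_powR R (1 / d%:R) _ 1 v _ v0 v1; rewrite powR1; apply.
      by rewrite divr_gt0 // ltr0n.
    by rewrite nnegrE.
  by rewrite !powR_gt1 // ltr1n.
move=> /existsNP[A /not_implyP[[finA AS] mA]]; right.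
have ker_growth := semidirectZ_kernel_growth (alpha := alpha) K_growth.
have [/mA//|] := growth_or_metacyclic G_tf piM u_gt1 ker_growth finA.
rewrite AS => -[x [s [SE px s_or xs]]].
exact: (metacyclic_classification G_tf piM SE px s_or xs).
Qed.
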